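(* For every finite graph $G$ and every weight distribution $w\in\mathbb{R}_{\geq 0}^{V(G)}$, the set $\mathcal{R}(w)$ of weight distributions reachable from $w$ is a compact subset of $\mathbb{R}_{\geq 0}^{V(G)}$ (with the standard topology).
   Context: A weight distribution on a graph $G$ is a function $w\in\mathbb{R}_{\geq 0}^{V(G)}$; for $S\subseteq V(G)$ write $w(S)=\sum_{x\in S}w(x)$. For a finite nonempty set $T\subseteq V(G)$ inducing a connected subgraph, the sharing move on $T$ changes $w$ to $w'$ where $w'(x)=w(T)/|T|$ for $x\in T$ and $w'(x)=w(x)$ for $x\notin T$. A weight distribution $w'$ is reachable from $w$ if some finite sequence of sharing moves changes $w$ to $w'$; $\mathcal{R}(w)$ denotes the set of weight distributions reachable from $w$. *)

(* Defs.v *)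
From HB Require Import structures.
From mathcomp Require Import all_boot all_order all_algebra.
From mathcomp Require Import all_classical all_reals all_analysis.

Set Implicit Arguments.
Unset Strict Implicit.
Unset Printing Implicit Defensive.

Import Order.TTheory GRing.Theory Num.Theory.
Import numFieldNormedType.Exports.

Local Open Scope ring_scope.
Local Open Scope classical_set_scope.

Section Sharing.
Variables (R : realType) (V : finType) (adj : rel V).

Definition weight_distribution (w : V -> R) : Prop := forall x, 0 <= w x.

Definition weight (w : V -> R) (S : {set V}) : R := \sum_(x in S) w x.

Definition induced (T : {set V}) : rel V :=
  [rel x y | [&& x \in T, y \in T & adj x y]].

Definition induces_connected (T : {set V}) : bool :=
  (T != finset.set0) && [forall x in T, forall y in T, connect (induced T) x y].

Definition share (w : V -> R) (T : {set V}) : V -> R :=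
  fun x => if x \in T then weight w T / #|T|%:R else w x.

Definition reachable (w : V -> R) : set (V -> R) :=
  [set w' | exists2 s : seq {set V},
              all induces_connected s & w' = foldl share w s].

End Sharing.

(* Main.v *)
Require Import Defs.
From HB Require Import structures.
From mathcomp Require Import all_boot all_order all_algebra.
From mathcomp Require Import all_classical all_reals all_analysis.
From mathcomp Require Import ring lra.

Set Implicit Arguments.
Unset Strict Implicit.
Unset Printing Implicit Defensive.

Import Order.TTheory GRing.Theory Num.Theory.
Import numFieldNormedType.Exports.

Local Open Scope ring_scope.
Local Open Scope classical_set_scope.

(* The values stay in a box, so it suffices that every [z] approachable from
   [w], i.e. a limit of reachable distributions, is reachable. Moves are
   nonexpansive for the sup distance and are orthogonal projections, so a move
   that changes the distribution strictly decreases the energy [\sum_x f x ^+ 2].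

   Locally: if [f] is close enough to [z] and [z] is approachable from [f], then
   a word bringing [f] closer to [z] loses little energy, hence uses only moves
   fixing [z]. Such moves preserve the weight of every connected component of
   every level set of [z], so sharing on each of these components turns [f]
   into [z].

   Globally: from [w], follow a sequence of reachable distributions from which
   [z] is still approachable and whose energy decreases greedily. The local
   statement makes a cluster point [l] of this sequence reachable, and greed
   makes its energy minimal. If [l <> z], finiteness of the set of moves gives
   a nontrivial move from [l] keeping [z] approachable, a contradiction. *)

Section SharingMoves.
Variables (R : realType) (V : finType).
Implicit Types (f g h z : V -> R) (T C : {set V}).

(** * Sup-distance estimates *)

Definition close f g (eps : R) := forall x, `|f x - g x| <= eps.

Lemma close_le f g (d e : R) : d <= e -> close f g d -> close f g e.
Proof. by move=> de fg x; apply: le_trans (fg x) de. Qed.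

Lemma close_sym f g (e : R) : close f g e -> close g f e.
Proof. by move=> fg x; rewrite distrC. Qed.

Lemma close_trans f g h (d e : R) : close f g d -> close g h e -> close f h (d + e).
Proof.
by move=> fg gh x; apply: le_trans (ler_distD (g x) _ _) (lerD (fg x) (gh x)).
Qed.

Lemma close_eq f g : (forall e : R, 0 < e -> close f g e) -> f = g.
Proof.
move=> fg; apply/funext => x; apply/eqP; rewrite -subr_eq0 -normr_le0.
by apply/ler_addgt0Pr => e e0; rewrite add0r; apply: fg.
Qed.

Lemma close_weight f g (e : R) T :
  close f g e -> `|weight f T - weight g T| <= e * #|T|%:R.
Proof.
move=> fg; rewrite /weight -sumrB (le_trans (ler_norm_sum _ _ _))//.
by rewrite mulr_natr -sumr_const; apply: ler_sum => x _; apply: fg.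
Qed.

Lemma close_share f g (e : R) T : close f g e -> close (share f T) (share g T) e.
Proof.
move=> fg x; rewrite /share; case: ifPn => [xT|_]; last exact: fg.
have T0 : 0 < #|T|%:R :> R by rewrite ltr0n; apply/card_gt0P; exists x.
by rewrite -mulrBl normrM normfV (gtr0_norm T0) ler_pdivrMr// close_weight.
Qed.

Lemma close_foldl_share s f g (e : R) :
  close f g e -> close (foldl (@share R V) f s) (foldl (@share R V) g s) e.
Proof. by elim: s f g => //= T s IHs f g fg; apply/IHs/close_share. Qed.

(** * Energy and its decrease under moves *)

Definition energy f : R := \sum_x f x ^+ 2.

Lemma energy_share f T :
  energy f = energy (share f T) + \sum_x (f x - share f T x) ^+ 2.
Proof.
rewrite /energy -big_split/=; apply/eqP; rewrite -subr_eq0 -sumrB.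
pose a := weight f T / #|T|%:R.
(* The defect in Pythagoras' identity is [2 * a * (f x - a)] on [T]; it sums to zero because [a] is
   the mean of [f] on [T]. *)
rewrite (eq_bigr (fun x => if x \in T then 2 * a * (f x - a) else 0)); last first.
  by move=> x _; rewrite /share -/a; case: ifP => _; ring.
rewrite -big_mkcond -big_distrr/= sumrB sumr_const -/(weight f T) -[a *+ _]mulr_natr.
have [T0|T0] := eqVneq #|T| 0%N.
  by rewrite /weight (cards0_eq T0) big_set0 cards0 mulr0 subrr mulr0.
by rewrite divfK ?pnatr_eq0// subrr mulr0.
Qed.

Lemma energy_share_le f T : energy (share f T) <= energy f.
Proof.
by rewrite (energy_share f T) lerDl sumr_ge0// => x _; rewrite sqr_ge0.
Qed.

Lemma energy_share_eq f T : energy f <= energy (share f T) -> share f T = f.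
Proof.
rewrite {1}(energy_share f T) gerDl => le0; apply/funext => x; apply/esym/eqP.
have sq0 y : true -> 0 <= (f y - share f T y) ^+ 2 by rewrite sqr_ge0.
have /eqP : \sum_y (f y - share f T y) ^+ 2 = 0.
  by apply/eqP; rewrite eq_le le0 sumr_ge0.
by rewrite psumr_eq0// => /allP/(_ x (mem_index_enum x)); rewrite sqrf_eq0 subr_eq0.
Qed.

Lemma energy_foldl_share_le s f : energy (foldl (@share R V) f s) <= energy f.
Proof.
by elim: s f => //= T s IHs f; apply: le_trans (IHs _) (energy_share_le f T).
Qed.

Lemma close_share_energy f T (e : R) : 0 <= e ->
  energy f - energy (share f T) <= e ^+ 2 -> close f (share f T) e.
Proof.
rewrite (energy_share f T) addrC addKr => e0 le_e2 x.
rewrite -(ler_pXn2r (n := 2))// ?nnegrE// real_normK ?num_real//.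
apply: le_trans le_e2; rewrite (bigD1 x)//= lerDl sumr_ge0// => y _.
by rewrite sqr_ge0.
Qed.

Lemma energy_continuous z (eta : R) : 0 < eta ->
  exists2 e : R, 0 < e & forall f, close f z e -> `|energy f - energy z| <= eta.
Proof.
(* For [e <= 1], each [f x ^+ 2 - z x ^+ 2] is at most [e * (2 * |z x| + 1)] in absolute value. The
   last [+ 1] keeps [c] positive even when [V] is empty. *)
move=> eta0; pose c := \sum_x (2 * `|z x| + 1) + 1.
have c0 : 0 < c by rewrite ltr_wpDl// sumr_ge0// => x _; rewrite addr_ge0// mulr_ge0.
exists (Num.min 1 (eta / c)); first by rewrite lt_min ltr01 divr_gt0.
move=> f; set e := Num.min _ _ => fz.
have e1 : e <= 1 by rewrite ge_min lexx.
have ec : e * c <= eta by rewrite -ler_pdivlMr// ge_min lexx orbT.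
have e0 : 0 <= e by rewrite le_min ler01 divr_ge0// ltW.
apply: le_trans ec; rewrite /energy -sumrB (le_trans (ler_norm_sum _ _ _))//.
rewrite mulrDr mulr1 -[leLHS]addr0 lerD// mulr_sumr ler_sum// => x _.
rewrite subr_sqr normrM ler_pM// (_ : f x + z x = 2 * z x + (f x - z x)); last by ring.
rewrite (le_trans (ler_normD _ _))// normrM ger0_norm// lerD2l.
exact: le_trans (fz x) e1.
Qed.

(** * Moves near a given distribution *)

Lemma uniform_eps (I : finType) (P : I -> R -> Prop) :
    (forall i (d e : R), d <= e -> P i e -> P i d) ->
    (forall i, exists2 e : R, 0 < e & P i e) ->
  exists2 e : R, 0 < e & forall i, P i e.
Proof.
move=> mono /(_ _)/cid2-/all_sig2[e e0 Pe].
exists (\big[Num.min/1]_i e i) => [|i].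
  by apply: lt_bigmin => // i _; apply: e0.
by apply: mono (Pe i); apply: bigmin_le_cond.
Qed.

Lemma share_isolated z :
  exists2 d : R, 0 < d & forall T, close (share z T) z d -> share z T = z.
Proof.
apply: (uniform_eps (P := fun T d => close (share z T) z d -> share z T = z)).
  by move=> T d e de He Hd; apply: He; apply: close_le Hd.
move=> T; have [Tz|Tz] := pselect (share z T = z); first by exists 1.
have /existsNP[x /eqP xz] : ~ forall x, share z T x = z x.
  by move=> Tz'; apply: Tz; apply/funext.
(* Half of a nonzero displacement is too small a radius to contain it. *)
exists (`|share z T x - z x| / 2); first by rewrite divr_gt0// normr_gt0 subr_eq0.
move=> /(_ x); rewrite ler_pdivlMr// mulr_natr mulr2n gerDl normr_le0 subr_eq0.
by rewrite (negbTE xz).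
Qed.

(* A word starting close to [z] and losing little energy moves only slightly, so
   by [share_isolated] each of its moves fixes [z] and therefore cannot take
   the current configuration away from [z]. *)
Lemma moves_fix_close z : exists2 d : R, 0 < d & forall f s, close f z d ->
  energy f - energy (foldl (@share R V) f s) <= d ^+ 2 ->
  {in s, forall T, share z T = z}.
Proof.
have [d d0 dP] := share_isolated z; exists (d / 3); first by rewrite divr_gt0.
set e := d / 3 => f s; have e0 : 0 < e by rewrite divr_gt0.
elim: s f => //= T s IHs f fz drop.
have Tz : share z T = z.
  (* One third for each leg: [share z T] to [share f T], then to [f], then to [z]. *)
  apply: dP; have -> : d = e + (e + e) by rewrite /e; field.
  apply: close_trans (close_sym (close_share T fz)) _.
  apply: close_trans fz; apply/close_sym/close_share_energy; first exact: ltW.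
  by apply: le_trans drop; rewrite lerD2l lerN2 energy_foldl_share_le.
move=> U; rewrite inE => /orP[/eqP->//|]; apply: (IHs (share f T)).
  by rewrite -Tz; apply: close_share.
by apply: le_trans drop; rewrite lerD2r energy_share_le.
Qed.

(** * Conservation of weight *)

Lemma weight_share_sub f T C : T \subset C -> weight (share f T) C = weight f C.
Proof.
move=> TC; rewrite /weight (big_setID T)/= [RHS](big_setID T)/=; congr (_ + _).
  rewrite (finset.setIidPr TC) (eq_bigr (fun=> weight f T / #|T|%:R)); last first.
    by move=> x xT; rewrite /share xT.
  rewrite sumr_const -[LHS]mulr_natr; have [T0|T0] := eqVneq #|T| 0%N.
    by rewrite (cards0_eq T0) big_set0 cards0 mulr0.
  by rewrite divfK// pnatr_eq0.
by apply: eq_bigr => x; rewrite inE /share => /andP[/negbTE->].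
Qed.

Lemma weight_share_disjoint f T C :
  [disjoint C & T]%B -> weight (share f T) C = weight f C.
Proof.
move=> CT; apply: eq_bigr => x xC; rewrite /share ifF//.
exact: (disjointFr CT).
Qed.

Section Reachability.
Variables (adj : rel V) (adj_sym : symmetric adj).

(** * Components of level sets *)

Section LevelComponents.
Variable z : V -> R.

(** Deleting the edges across which [z] changes leaves a graph whose connected components are those
    of the level sets of [z]. *)
Definition level_rel : rel V := [rel x y | adj x y && (z x == z y)].

Definition level_comp (x : V) : {set V} := [set y | connect level_rel x y]%SET.

Lemma level_connect_sym : connect_sym level_rel.
Proof. by apply: sym_connect_sym => x y; rewrite /level_rel/= adj_sym eq_sym. Qed.

Lemma level_comp_refl x : x \in level_comp x.
Proof. by rewrite inE. Qed.

Lemma level_comp_eq x y : y \in level_comp x -> level_comp x = level_comp y.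
Proof.
rewrite inE => xy; apply/setP => t; rewrite !inE.
exact: (same_connect level_connect_sym).
Qed.

Lemma level_comp_const x y : y \in level_comp x -> z y = z x.
Proof.
rewrite inE => /connectP[p xp ->] {y}; elim: p x xp => //= y p IHp x.
by move=> /andP[/andP[_ /eqP->]]; apply: IHp.
Qed.

Lemma level_comp_connected x : induces_connected adj (level_comp x).
Proof.
apply/andP; split; first by apply/finset.set0Pn; exists x; apply: level_comp_refl.
(* By symmetry any two vertices can be joined through [x]. *)
suff xC y : y \in level_comp x -> connect (Defs.induced adj (level_comp x)) x y.
  apply/forall_inP => y /xC xy; apply/forall_inP => t /xC; apply: connect_trans.
  rewrite (sym_connect_sym _ x)// in xy => a b; rewrite /Defs.induced/=.
  by rewrite adj_sym andbCA.
rewrite inE => /connectP[p xp ->] {y}.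
elim/last_ind: p xp => [|p y IHp]; first by rewrite connect0.
rewrite rcons_path last_rcons => /andP[xp py]; apply: connect_trans (IHp xp) _.
have xl : connect level_rel x (last x p) by apply/connectP; exists p.
apply: connect1; rewrite /Defs.induced/= !inE xl (connect_trans xl (connect1 py)).
by case/andP: py.
Qed.

Lemma share_level_comp f x :
    weight f (level_comp x) = weight z (level_comp x) ->
  share f (level_comp x) = fun y => if y \in level_comp x then z y else f y.
Proof.
move=> fz; apply/funext => y; rewrite /share; case: ifPn => // yC.
rewrite fz /weight (eq_bigr (fun=> z x)) => [|t]; last exact: level_comp_const.
rewrite sumr_const (level_comp_const yC) -[z x *+ _]mulr_natr mulfK// pnatr_eq0 -lt0n.
by apply/card_gt0P; exists y.
Qed.

(** A move fixing [z] forces [z] to equal its mean throughout [T], so paths inside [T] never leave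
    the level set. *)
Lemma fixed_move_sub_level_comp T x :
  induces_connected adj T -> share z T = z -> x \in T -> T \subset level_comp x.
Proof.
move=> /andP[_ /forall_inP Tc] Tz xT; have zT y : y \in T -> z y = weight z T / #|T|%:R.
  by move=> yT; rewrite -{1}Tz /share yT.
apply/fintype.subsetP => y yT; rewrite inE.
have /forall_inP/(_ y yT) := Tc x xT; apply: connect_sub => a b /and3P[aT bT ab].
by apply: connect1; rewrite /level_rel/= ab !zT ?eqxx.
Qed.

(** Such a [T] is either disjoint from the component or contained in it. *)
Lemma weight_level_comp_share f T x : induces_connected adj T -> share z T = z ->
  weight (share f T) (level_comp x) = weight f (level_comp x).
Proof.
move=> Tc Tz; have [CT|] := boolP ([disjoint level_comp x & T])%B.
  exact: weight_share_disjoint.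
rewrite -finset.setI_eq0 => /finset.set0Pn[y /finset.setIP[yC yT]].
apply: weight_share_sub; rewrite (level_comp_eq yC).
exact: fixed_move_sub_level_comp.
Qed.

Lemma weight_level_comp_foldl_share s f x :
    all (induces_connected adj) s -> {in s, forall T, share z T = z} ->
  weight (foldl (@share R V) f s) (level_comp x) = weight f (level_comp x).
Proof.
elim: s f => //= T s IHs f /andP[Tc sc] sz.
rewrite IHs// => [|U Us]; last by apply: sz; rewrite inE Us orbT.
by apply: weight_level_comp_share => //; apply: sz; rewrite inE eqxx.
Qed.

Lemma share_level_comp_id x : share z (level_comp x) = z.
Proof. by rewrite share_level_comp//; apply/funext => y; case: ifP. Qed.

Lemma reachable_of_level_weights f :
    (forall x, weight f (level_comp x) = weight z (level_comp x)) ->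
  reachable adj f z.
Proof.
move=> fz; exists [seq level_comp x | x <- enum V].
  by apply/allP => _ /mapP[x _ ->]; apply: level_comp_connected.
(* Each sharing installs [z] on one component and keeps all component weights, so the hypothesis on
   [g] survives the induction. Components occurring several times in the list do no harm. *)
suff shareE l g : (forall x, weight g (level_comp x) = weight z (level_comp x)) ->
    foldl (@share R V) g [seq level_comp x | x <- l] =
    fun y => if has (fun x => y \in level_comp x) l then z y else g y.
  rewrite shareE//; apply/funext => y; rewrite ifT//; apply/hasP; exists y.
    by rewrite mem_enum.
  exact: level_comp_refl.
elim: l g => //= x l IHl g gz; rewrite IHl => [|t].
  apply/funext => y; rewrite share_level_comp//.
  by case: has => //=; rewrite ?orbT ?orbF.
rewrite weight_level_comp_share//; first exact: level_comp_connected.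
exact: share_level_comp_id.
Qed.

End LevelComponents.

(** * Reachable and approachable distributions *)

Lemma reachable_refl f : reachable adj f f.
Proof. by exists [::]. Qed.

Lemma reachable_trans f g h :
  reachable adj f g -> reachable adj g h -> reachable adj f h.
Proof.
move=> [s sc ->] [t tc ->]; exists (s ++ t); first by rewrite all_cat sc.
by rewrite foldl_cat.
Qed.

Lemma reachable_share f T : induces_connected adj T -> reachable adj f (share f T).
Proof. by move=> Tc; exists [:: T]; rewrite //= Tc. Qed.

Lemma energy_reachable_le f g : reachable adj f g -> energy g <= energy f.
Proof. by move=> [s _ ->]; apply: energy_foldl_share_le. Qed.

(** Membership of [z] in the closure of the set reachable from [f]. *)
Definition approachable f z :=
  forall e : R, 0 < e -> exists2 g, reachable adj f g & close g z e.

(** Otherwise, there being finitely many moves, one radius [e] separates [z] from everything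
    reachable after a nontrivial move. A word ending within [e] of [z] could then only consist of
    idle moves, and [f] itself is not that close to [z]. *)
Lemma approachable_step f z : approachable f z -> f <> z ->
  exists T, [/\ induces_connected adj T, share f T <> f & approachable (share f T) z].
Proof.
move=> fz fNz; apply/not_existsP => noT.
have [d d0 dP] : exists2 d : R, 0 < d & ~ close f z d.
  apply/not_exists2P => nod; apply: fNz; apply: close_eq => e e0.
  by have [//|/contrapT] := nod e.
pose P T (e : R) := induces_connected adj T -> share f T <> f ->
  forall g, reachable adj (share f T) g -> ~ close g z e.
have [e e0 eP] : exists2 e : R, 0 < e & forall T, P T e.
  apply: uniform_eps => [T a b ab Pb Tc Tf g fg gz|T].
    by apply: (Pb Tc Tf g fg); apply: close_le gz.
  have [Tc|nTc] := pselect (induces_connected adj T); last by exists 1 => // /nTc.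
  have [Tf|nTf] := pselect (share f T = f); first by exists 1.
  have /existsNP[e /not_implyP[e0 /forall2NP eP]] : ~ approachable (share f T) z.
    by move=> fTz; apply: (noT T).
  by exists e => // _ _ g fg gz; have [] := eP g.
have [_ [s sc ->] sz] := fz (Num.min d e) ltac:(by rewrite lt_min d0 e0).
elim: s sc sz => /= [_|T s IHs /andP[Tc sc]] sz.
  by apply: dP; apply: close_le sz; rewrite ge_min lexx.
have [Tf|Tf] := pselect (share f T = f); first by rewrite Tf in sz; apply: IHs.
apply: (eP T Tc Tf (foldl (@share R V) (share f T) s)); first by exists s.
by apply: close_le sz; rewrite ge_min lexx orbT.
Qed.

Lemma reachable_of_close z : exists2 d : R, 0 < d &
  forall f, close f z d -> approachable f z -> reachable adj f z.
Proof.
have [d d0 dP] := moves_fix_close z.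
(* Both ends of the word have energy within [d ^+ 2 / 2] of that of [z], so the word loses at most
   [d ^+ 2], as [dP] requires. *)
have d20 : 0 < d ^+ 2 / 2 by rewrite divr_gt0// exprn_gt0.
have [e e0 eP] := energy_continuous z d20.
exists (Num.min d e); first by rewrite lt_min d0.
move=> f fz0.
have fz : close f z d by apply: close_le fz0; rewrite ge_min lexx.
have fze : close f z e by apply: close_le fz0; rewrite ge_min lexx orbT.
move=> fz_app; apply: reachable_of_level_weights => x.
apply/eqP; rewrite -subr_eq0 -normr_le0; apply/ler_addgt0Pr => r r0; rewrite add0r.
set C := level_comp z x.
have C0 : 0 < #|C|%:R :> R.
  by rewrite ltr0n; apply/card_gt0P; exists x; apply: level_comp_refl.
(* A pointwise error of [r / #|C|] changes the weight of [C] by at most [r]. *)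
have [_ [s sc ->] sz] := fz_app (Num.min e (r / #|C|%:R))
  ltac:(by rewrite lt_min e0 divr_gt0).
rewrite -(weight_level_comp_foldl_share f x sc); last first.
  apply: (dP f) => //.
  have := eP _ fze; have := eP (foldl (@share R V) f s).
  move=> /(_ ltac:(by apply: close_le sz; rewrite ge_min lexx)).
  by rewrite !ler_norml => /andP[? ?] /andP[? ?]; lra.
have := close_weight C sz; move/le_trans; apply.
by rewrite -ler_pdivlMr// ge_min lexx orbT.
Qed.

(** * Boxes and cluster points *)

Definition box (M : R) : set (V -> R) := [set f | forall x, 0 <= f x <= M].

Lemma box_share M f T : box M f -> box M (share f T).
Proof.
move=> fM x; rewrite /share; case: ifPn => [xT|_]; last exact: fM.
have T0 : 0 < #|T|%:R :> R by rewrite ltr0n; apply/card_gt0P; exists x.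
rewrite ler_pdivrMr//; apply/andP; split.
  by rewrite divr_ge0// sumr_ge0// => y _; case/andP: (fM y).
by rewrite mulr_natr -sumr_const; apply: ler_sum => y _; case/andP: (fM y).
Qed.

Lemma box_reachable M f g : box M f -> reachable adj f g -> box M g.
Proof.
by move=> fM [s _ ->]; elim: s f fM => //= T s IHs f fM; apply/IHs/box_share.
Qed.

(** Tychonoff applies, since the pointwise topology is the product topology. *)
Lemma compact_box M : compact (box M : set {ptws V -> R}).
Proof.
have -> : box M = [set f | forall x, `[0, M] (f x)].
  by apply/seteqP; split=> f fM x; have := fM x; rewrite /= in_itv.
apply: (@tychonoff V (fun=> R) (fun=> `[0, M])) => x; exact: segment_compact.
Qed.

(** A finite intersection of coordinatewise neighbourhoods, [V] being finite. *)
Lemma nbhs_close z (e : R) :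
  0 < e -> nbhs (z : {ptws V -> R}) [set g | close g z e].
Proof.
move=> e0; apply: (@filter_forall _ V (fun x g => `|g x - z x| <= e) _
  (nbhs_filter (z : {ptws V -> R}))) => x.
have zx : nbhs (z x) [set r : R | `|r - z x| <= e].
  apply/nbhs_ballP; exists e => //= r; rewrite /ball/= distrC; exact: ltW.
exact: (@proj_continuous V (fun=> R) x z _ zx).
Qed.

Lemma box_cluster M (u : nat -> V -> R) : (forall n, box M (u n)) ->
  exists z, forall m (e : R), 0 < e -> exists2 n, (m <= n)%N & close (u n) z e.
Proof.
move=> uM; have [|z [_ zu]] := @compact_box M (u @ \oo) _.
  by exists 0%N => // n _; apply: uM.
exists z => m e /(nbhs_close z) ze.
have [|_ [[n mn <-] uz]] := zu (u @` [set n | (m <= n)%N]) _ _ ze; last by exists n.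
by exists m => // n mn; exists n.
Qed.

(** * Greedy energy descent *)

Lemma halving_step f z : approachable f z -> exists g,
  [/\ reachable adj f g, approachable g z & forall h, reachable adj f h ->
      approachable h z -> energy g * 2 <= energy f + energy h].
Proof.
move=> fz.
(* The choice of [g] at least halves the excess of the energy over [inf S]; comparing with every [h]
   keeps the infimum out of the statement. *)
pose S := [set energy h | h in [set h | reachable adj f h /\ approachable h z]].
have Slb : has_lbound S.
  by exists 0 => _ [h _ <-]; rewrite /energy sumr_ge0// => x _; rewrite sqr_ge0.
have Sf : S (energy f) by exists f => //; split=> //; apply: reachable_refl.
have infS h : reachable adj f h -> approachable h z -> inf S <= energy h.
  by move=> fh hz; apply: ge_inf => //; exists h.
have [fS|fS] := lerP (energy f) (inf S).
  exists f; split=> //; first exact: reachable_refl.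
  by move=> h fh hz; have := infS h fh hz; lra.
have [||_ [g [fg gz] <-] gS] := @inf_lt _ S ((energy f + inf S) / 2).
- by exists (energy f).
- by lra.
- by exists g; split=> // h fh hz; have := infS h fh hz; lra.
Qed.

Lemma approachable_reachable M f z :
  box M f -> approachable f z -> reachable adj f z.
Proof.
move=> fM fz; pose P g g' := approachable g z -> [/\ reachable adj g g',
  approachable g' z & forall h, reachable adj g h -> approachable h z ->
  energy g' * 2 <= energy g + energy h].
have [next nextP] : {next & forall g, P g (next g)}.
  apply: choice => g; have [gz|] := pselect (approachable g z).
    by have [g' g'P] := halving_step gz; exists g'.
  (* A default value; [P g] is vacuous here. *)
  by exists g.
pose u n := iter n next f.
have uz n : approachable (u n) z.
  by elim: n => //= n /nextP[].
have uS n : reachable adj (u n) (u n.+1) by have [] := nextP _ (uz n).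
have u_reach m n : (m <= n)%N -> reachable adj (u m) (u n).
  elim: n => [|n IHn]; first by rewrite leqn0 => /eqP->; apply: reachable_refl.
  rewrite leq_eqVlt => /predU1P[->|/IHn mn]; first exact: reachable_refl.
  exact: reachable_trans (uS n).
have [n|l ul] := @box_cluster M u; first exact: box_reachable fM (u_reach 0%N n _).
have u_l m : reachable adj (u m) l.
  (* Some [u n] with [m <= n] is near [l], and later terms of the sequence show that [l] is
     approachable from it. *)
  have [d d0 dP] := reachable_of_close l; have [n mn nl] := ul m d d0.
  apply: reachable_trans (u_reach m n mn) _; apply: dP => // e e0.
  by have [k nk kl] := ul n e e0; exists (u k) => //; apply: u_reach.
have lz : approachable l z.
  (* A word taking a nearby [u n] close to [z] is applied to [l]; by nonexpansiveness it ends close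
     to [z] too. *)
  move=> e e0; have e20 : 0 < e / 2 by rewrite divr_gt0.
  have [n _ nl] := ul 0%N _ e20; have [_ [s sc ->] sz] := uz n _ e20.
  exists (foldl (@share R V) l s); first by exists s.
  by rewrite [e]splitr; apply: close_trans sz; apply/close_foldl_share/close_sym.
have [<-|/(approachable_step lz)[T [Tc Tl Tz]]] := pselect (l = z); first exact: u_l 0%N.
have lT : energy (share l T) < energy l.
  by rewrite ltNge; apply/negP => /energy_share_eq.
(* If [u n] exceeds the energy of [l] by at most half the drop, comparison with [share l T] puts
   [u n.+1] strictly below [l] in energy, although [l] is reachable from [u n.+1]. *)
have drop0 : 0 < (energy l - energy (share l T)) / 2 by lra.
have [e e0 eP] := energy_continuous l drop0.
have [n _ /eP] := ul 0%N e e0; rewrite ler_norml => /andP[_ nl].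
have [_ _ /(_ (share l T))] := nextP _ (uz n).
move=> /(_ (reachable_trans (u_l n) (reachable_share l Tc)) Tz).
by have := energy_reachable_le (u_l n.+1); rewrite /=; lra.
Qed.

Lemma compact_reachable M f :
  box M f -> compact (reachable adj f : set {ptws V -> R}).
Proof.
move=> fM; apply: (subclosed_compact _ (@compact_box M)); last first.
  by move=> g; apply: box_reachable.
(* Closedness in the box: a point of the closure is approachable, hence reachable. *)
move=> z zR; apply: approachable_reachable fM _ => e e0.
by have [g [fg gz]] := zR _ (nbhs_close z e0); exists g.
Qed.

End Reachability.
End SharingMoves.

Theorem theorem4p5 (R : realType) (V : finType) (adj : rel V)
    (adj_sym : symmetric adj) (adj_irr : irreflexive adj)
    (w : V -> R) (w_wd : weight_distribution w) :
  reachable adj w `<=` [set w' : V -> R | weight_distribution w'] /\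
  compact (reachable adj w : set {ptws V -> R}).
Proof.
(* By nonnegativity the total weight bounds every single value. *)
have wM : box (\sum_x w x) w.
  by move=> x; rewrite w_wd (bigD1 x)//= lerDl sumr_ge0.
split; last exact: compact_reachable wM.
by move=> f /(box_reachable wM) fM x; case/andP: (fM x).
Qed.
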